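(* Let $(X,d,A)$ be a metric pair such that $(X/A,d_1,[A])$ is separable and not uniformly discrete, let $B=\widehat V(X,A)$, let $(J,\Sigma)$ be admissible covariance data on $B$, let $t>0$, let $R\ge1$ be an integer, and let $u_1,\dots,u_R$ be independent samples from the Gaussian measure $\gamma_\Sigma$ on $\ell^2$. Define the random feature map $$\Phi_R(x):=\frac1{\sqrt R}\bigl(e^{i\sqrt t\,\langle Jx,u_1\rangle_{\ell^2}},\dots,e^{i\sqrt t\,\langle Jx,u_R\rangle_{\ell^2}}\bigr)\in\mathbb C^R,\qquad x\in B.$$ Then $\Phi_R\colon(B,\|\cdot\|_{W_1})\to(\mathbb C^R,\|\cdot\|_{\ell^2})$ is Lipschitz, with Lipschitz constant satisfying $$\mathrm{Lip}(\Phi_R)\le\sqrt t\,\|J\|\,\left(\frac1R\sum_{r=1}^R\|u_r\|_{\ell^2}^2\right)^{1/2},$$ where $\|J\|$ is the operator norm of $J\colon(B,\|\cdot\|_{W_1})\to\ell^2$.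
   Context: A metric pair $(X,d,A)$ is a metric space with a distinguished subset $A\subseteq X$. Put $d(x,A):=\inf_{a\in A}d(x,a)$ and $d_1(x,y):=\min\bigl(d(x,y),\,d(x,A)+d(y,A)\bigr)$. Let $X/A$ be the quotient collapsing $A$ to a point $[A]$; $d_1$ descends to $X/A$. Standing assumption: $A$ is nonempty and $d_1$ is a genuine metric on $X/A$ (i.e. $d(x,A)>0$ for $x\notin A$). A metric space is uniformly discrete if distances between distinct points are bounded below by some $\varepsilon>0$. $V(X,A):=V(X)/V(A)$ ($V(Y)$ the free real vector space on $Y$) has basis $(e_u)_{u\in X/A\setminus\{[A]\}}$ and norm $\|\sum_uc_ue_u\|_{W_1}=\sup\{\sum_uc_uf(u): f\colon X/A\to\mathbb R,\ f([A])=0,\ \mathrm{Lip}_{d_1}(f)\le1\}$. $B=\widehat V(X,A)$ is its Banach completion (the Lipschitz-free space $\mathcal F(X/A,d_1)$). Admissible covariance data $(J,\Sigma)$: fix a sequence $(\ell_n)_{n\ge1}\subset B^\ast$ with $\|\ell_n\|_{B^\ast}\le1$ that is norming ($\|x\|_{W_1}=\sup_n|\ell_n(x)|$ for all $x\in B$) and a strictly positive $(w_n)\in\ell^2$; $J\colon B\to\ell^2$, $Jx:=(w_n\ell_n(x))_n$. $\Sigma$ is the positive trace-class operator on the real Hilbert space $\ell^2$ with $\Sigma e_n=\sigma_ne_n$ in the standard basis, $\sigma_n\ge0$, $\sum_n\sigma_n<\infty$. $\gamma_\Sigma$ is the centered Gaussian Radon probability measure on $\ell^2$ with $\int e^{i\langle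 h,u\rangle}\,d\gamma_\Sigma(u)=\exp(-\tfrac12\langle\Sigma h,h\rangle)$ for all $h\in\ell^2$. The Lipschitz bound is for each realization of $u_1,\dots,u_R\in\ell^2$. *)

(* Defs.v *)
From HB Require Import structures.
From mathcomp Require Import all_boot all_order all_algebra.
From mathcomp Require Import generic_quotient ring_quotient.
From mathcomp Require Import all_classical all_reals all_analysis.
From mathcomp Require Import freeg.
From mathcomp Require Import complex.
From mathcomp Require Import ring lra.

Set Implicit Arguments.
Unset Strict Implicit.
Unset Printing Implicit Defensive.

Import Order.TTheory GRing.Theory Num.Theory.
Import numFieldNormedType.Exports.
Local Open Scope classical_set_scope.
Local Open Scope ring_scope.
Local Open Scope quotient_scope.

Section lipschitz.
Context {R : realType} {T U : Type}.
Variables (dT : T -> T -> R) (dU : U -> U -> R) (f : T -> U).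

Definition is_lipschitz := exists K : R, forall x y, dU (f x) (f y) <= K * dT x y.

(* As [0 / 0 = 0], for (pseudo)metrics the diagonal pairs contribute [0] to
   the supremum, which is [+oo] when [f] is not Lipschitz. *)
Definition Lip : \bar R :=
  ereal_sup [set (dU (f p.1) (f p.2) / dT p.1 p.2)%:E | p in [set: T * T]].

End lipschitz.

Definition norm_dist {R : realType} {V : normedZmodType R} (x y : V) : R :=
  `|x - y|.

Section metric_space_notions.
Context {R : realType}.

Definition separable (T : topologicalType) :=
  exists2 D : set T, countable D & dense D.

Definition uniformly_discrete (T : metricType R) :=
  exists2 e : R, 0 < e & forall x y : T, x != y -> e <= mdist x y.

Definition dist_to (T : metricType R) (A : set T) (x : T) : R :=
  inf [set mdist x a | a in A].

End metric_space_notions.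

Record metricPair (R : realType) := MetricPair {
  mp_space :> metricType R ;
  mp_sub : set mp_space ;
  mp_sub_neq0 : mp_sub !=set0 ;
  mp_dist_gt0 : forall x, ~ mp_sub x -> 0 < dist_to mp_sub x
}.
Arguments mp_sub {R} P : rename.
Arguments mp_sub_neq0 {R} P : rename.

Section collapse.
Context {R : realType} (P : metricPair R).
Local Notation A := (mp_sub P).
Implicit Types x y z : P.

Definition d1 x y : R := Num.min (mdist x y) (dist_to A x + dist_to A y).

Lemma has_inf_dist x : has_inf [set mdist x a | a in A].
Proof.
split; first by have [a Aa] := mp_sub_neq0 P; exists (mdist x a), a.
by exists 0 => _ [a _ <-]; exact: mdist_ge0.
Qed.

Lemma dist_to_ge0 x : 0 <= dist_to A x.
Proof.
apply: lb_le_inf; first by have [] := has_inf_dist x.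
by move=> _ [a _ <-]; exact: mdist_ge0.
Qed.

Lemma dist_to_eq0 x : (dist_to A x == 0) = (x \in A).
Proof.
apply/idP/idP => [/eqP d0|]; rewrite inE.
  by apply: contrapT => /mp_dist_gt0; rewrite d0 ltxx.
move=> Ax; rewrite eq_le dist_to_ge0 andbT -(mdistxx x).
by apply: ge_inf; [by have [] := has_inf_dist x|exists x].
Qed.

Lemma dist_to_triangle x y : dist_to A x <= mdist x y + dist_to A y.
Proof.
rewrite -lerBlDl; apply: lb_le_inf; first by have [] := has_inf_dist y.
move=> _ [a Aa <-]; rewrite lerBlDl (le_trans _ (metric_triangle _ y _))//.
by apply: ge_inf; [by have [] := has_inf_dist x|exists a].
Qed.

Lemma d1_ge0 x y : 0 <= d1 x y.
Proof. by rewrite le_min mdist_ge0 addr_ge0 ?dist_to_ge0. Qed.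

Lemma d1xx x : d1 x x = 0.
Proof. by apply/eqP; rewrite eq_le d1_ge0 ge_min mdistxx lexx. Qed.

Lemma d1_sym x y : d1 x y = d1 y x.
Proof. by rewrite /d1 metric_sym addrC. Qed.

Lemma d1_triangle y x z : d1 x z <= d1 x y + d1 y z.
Proof.
have dA := dist_to_triangle; have dA0 := dist_to_ge0.
rewrite /d1; case: (leP (mdist x y) (dist_to A x + dist_to A y)) => _;
  case: (leP (mdist y z) (dist_to A y + dist_to A z)) => _.
- by rewrite ge_min metric_triangle.
- rewrite ge_min; apply/orP; right.
  by rewrite addrA lerD2r; exact: dA.
- rewrite ge_min; apply/orP; right.
  by rewrite -addrA lerD2l addrC [_ y z]metric_sym; exact: dA.
- rewrite ge_min; apply/orP; right; rewrite -addrA lerD2l.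
  by rewrite addrA lerDr addr_ge0.
Qed.

Definition collapse x y := (x == y) || (x \in A) && (y \in A).

Lemma d1_eq0 x y : (d1 x y == 0) = collapse x y.
Proof.
apply/idP/idP => [/eqP|/orP[/eqP ->|/andP[]]]; last 2 first.
- by rewrite d1xx.
- rewrite -!dist_to_eq0 => /eqP Ax /eqP Ay.
  by rewrite eq_le d1_ge0 andbT ge_min Ax Ay addr0 lexx orbT.
rewrite /d1 /collapse.
case: (leP (mdist x y) (dist_to A x + dist_to A y)) => _ => [/mdist_positivity ->|/eqP].
  by rewrite eqxx.
by rewrite paddr_eq0 ?dist_to_ge0// !dist_to_eq0 => ->; rewrite orbT.
Qed.

Lemma collapse_refl : reflexive collapse.
Proof. by move=> x; rewrite -d1_eq0 d1xx. Qed.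

Lemma collapse_sym : symmetric collapse.
Proof. by move=> x y; rewrite -!d1_eq0 d1_sym. Qed.

Lemma collapse_trans : transitive collapse.
Proof.
move=> y x z; rewrite -!d1_eq0 => /eqP xy /eqP yz.
by rewrite eq_le d1_ge0 andbT (le_trans (d1_triangle y x z))// xy yz addr0.
Qed.

Canonical collapse_equiv :=
  EquivRel collapse collapse_refl collapse_sym collapse_trans.

(* The quotient [X/A], with base point [A]. *)
Definition pair_quotient : Type := {eq_quot collapse}.
HB.instance Definition _ := Choice.on pair_quotient.
HB.instance Definition _ : EqQuotient P collapse pair_quotient :=
  EqQuotient.on pair_quotient.

Definition base_point : pair_quotient :=
  \pi_pair_quotient (projT1 (cid (mp_sub_neq0 P))).

Lemma pi_base_point x : (\pi_pair_quotient x == base_point) = (x \in A).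
Proof.
rewrite /base_point; case: cid => a Aa /=; rewrite piE /= /collapse.
rewrite (mem_set Aa) andbT; apply/orP/idP => [[/eqP -> |//]|]; last by right.
exact: mem_set.
Qed.

Definition quotient_dist (p q : pair_quotient) : R := d1 (repr p) (repr q).

Lemma quotient_dist_pi x y :
  quotient_dist (\pi_pair_quotient x) (\pi_pair_quotient y) = d1 x y.
Proof.
have d1_repr z : d1 (repr (\pi_pair_quotient z)) z = 0.
  by apply/eqP; rewrite d1_eq0 -(@eqquotE _ _ pair_quotient) reprK.
rewrite /quotient_dist; set x' := repr _; set y' := repr _.
apply/eqP; rewrite eq_le; apply/andP; split.
- rewrite (le_trans (d1_triangle x _ _))// d1_repr add0r.
  by rewrite (le_trans (d1_triangle y _ _))// [d1 y _]d1_sym d1_repr addr0.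
- rewrite (le_trans (d1_triangle x' _ _))// [d1 x _]d1_sym d1_repr add0r.
  by rewrite (le_trans (d1_triangle y' _ _))// d1_repr addr0.
Qed.

Lemma quotient_distxx p : quotient_dist p p = 0.
Proof. exact: d1xx. Qed.

Lemma quotient_dist_positivity p q : quotient_dist p q = 0 -> p = q.
Proof.
move/eqP; rewrite d1_eq0 -(@eqquotE _ _ pair_quotient) !reprK => /eqP.
exact.
Qed.

HB.instance Definition _ := @isMetric.Build R pair_quotient quotient_dist
  quotient_distxx quotient_dist_positivity
  (fun p q => d1_sym (repr p) (repr q))
  (fun q p r => d1_triangle (repr q) (repr p) (repr r)).

End collapse.

Section lipschitz_real.
Context {R : realType} {T : metricType R}.

Lemma Lip_le1 (f : T -> R) :
  (Lip mdist (@norm_dist R R) f <= 1)%E <->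
  forall x y, `|f x - f y| <= mdist x y.
Proof.
split=> [f1 x y|f1].
  have [->|xy] := eqVneq x y; first by rewrite subrr normr0 mdistxx.
  rewrite -[leRHS]mul1r -ler_pdivrMr ?mdist_gt0// -lee_fin.
  by apply: le_trans f1; apply: ereal_sup_ubound; exists (x, y).
apply: ge_ereal_sup => _ [[x y] _ <-] /=; rewrite lee_fin /norm_dist.
have [->|xy] := eqVneq x y; first by rewrite mdistxx invr0 mulr0.
by rewrite ler_pdivrMr ?mdist_gt0// mul1r.
Qed.

End lipschitz_real.

Section relative_chains.
Context {R : realType} (P : metricPair R).
Local Notation A := (mp_sub P).
Local Notation Q := (pair_quotient P).
Implicit Types (u : {freeg P / R}) (f : Q -> R).

(* [V(A)], as a subspace of the free vector space [V(X) = {freeg P / R}]. *)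
Definition chain_in_sub : {pred {freeg P / R}} :=
  fun u => all (fun x => x \in A) (dom u).

Lemma chain_in_subP u :
  reflect (forall x, x \notin A -> coeff x u = 0) (u \in chain_in_sub).
Proof.
apply: (iffP allP) => uA x.
  by move=> xA; apply: coeff_outdom; apply: contra xA; exact: uA.
by rewrite mem_dom; apply: contraTT => /uA ->; rewrite negbK.
Qed.

Lemma chain_in_sub_zmod : zmod_closed chain_in_sub.
Proof.
split=> [|u v /chain_in_subP uA /chain_in_subP vA]; apply/chain_in_subP => x xA.
  by rewrite coeff0.
by rewrite coeffB uA// vA// subrr.
Qed.

HB.instance Definition _ :=
  GRing.isZmodClosed.Build {freeg P / R} chain_in_sub chain_in_sub_zmod.

Lemma chain_in_subZ (c : R) u : u \in chain_in_sub -> c *: u \in chain_in_sub.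
Proof.
move=> /chain_in_subP uA; apply/chain_in_subP => x xA.
by rewrite coeffZ uA// mulr0.
Qed.

(* [V(X, A) = V(X) / V(A)]. *)
Definition relchain : Type := {ideal_quot chain_in_sub}.
HB.instance Definition _ := GRing.Zmodule.on relchain.

Definition relclass (u : {freeg P / R}) : relchain :=
  \pi_{ideal_quot chain_in_sub} u.

Lemma relclass_repr (a : relchain) : relclass (repr a) = a.
Proof. exact: reprK. Qed.

Lemma relclassP u v : reflect (relclass u = relclass v) (u - v \in chain_in_sub).
Proof. by rewrite Quotient.idealrBE; exact: eqP. Qed.

Lemma relclassB : zmod_morphism relclass.
Proof. by move=> u v; rewrite /relclass !piE. Qed.

HB.instance Definition _ :=
  GRing.isZmodMorphism.Build {freeg P / R} relchain relclass relclassB.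

Definition relchain_scale (c : R) (a : relchain) : relchain :=
  relclass (c *: (repr a : {freeg P / R})).

Lemma relchain_scaleE c u : relchain_scale c (relclass u) = relclass (c *: u).
Proof.
apply/relclassP; rewrite -scalerBr; apply: chain_in_subZ.
by apply/relclassP; rewrite relclass_repr.
Qed.

Lemma relchain_scaleA a b x :
  relchain_scale a (relchain_scale b x) = relchain_scale (a * b) x.
Proof. by rewrite -(relclass_repr x) !relchain_scaleE scalerA. Qed.

Lemma relchain_scale1 x : relchain_scale 1 x = x.
Proof. by rewrite -(relclass_repr x) relchain_scaleE scale1r. Qed.

Lemma relchain_scaleDr a x y :
  relchain_scale a (x + y) = relchain_scale a x + relchain_scale a y.
Proof.
rewrite -(relclass_repr x) -(relclass_repr y) -raddfD !relchain_scaleE.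
by rewrite scalerDr raddfD.
Qed.

Lemma relchain_scaleDl x a b :
  relchain_scale (a + b) x = relchain_scale a x + relchain_scale b x.
Proof.
by rewrite -(relclass_repr x) !relchain_scaleE scalerDl raddfD.
Qed.

HB.instance Definition _ := GRing.Zmodule_isLmodule.Build R relchain
  relchain_scaleA relchain_scale1 relchain_scaleDr relchain_scaleDl.

Lemma relclass_scalable : scalable relclass.
Proof. by move=> c u; rewrite -relchain_scaleE. Qed.

HB.instance Definition _ :=
  GRing.isScalable.Build R {freeg P / R} relchain *:%R relclass
    relclass_scalable.

(* [\sum_x c_x f([x])] for [u = \sum_x c_x x]; when [f([A]) = 0] it only
   depends on the class of [u] in [V(X, A)] ([pairing_relclass]). *)
Definition chain_pairing f u : R := \sum_(x <- dom u) coeff x u * f (\pi_Q x).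

Lemma chain_pairing_sub f u (s : seq P) : uniq s -> {subset dom u <= s} ->
  chain_pairing f u = \sum_(x <- s) coeff x u * f (\pi_Q x).
Proof.
move=> us sub; rewrite [RHS](bigID (mem (dom u))) /= [X in _ + X]big1 ?addr0.
  rewrite -big_filter; apply: perm_big; apply: uniq_perm.
  - exact: uniq_dom.
  - exact: filter_uniq.
  move=> x; rewrite mem_filter; apply/idP/andP => [xu|[]//].
  by split => //; exact: sub.
by move=> x xu; rewrite coeff_outdom ?mul0r.
Qed.

Lemma chain_pairing_linear f : linear_for *%R (chain_pairing f).
Proof.
move=> c u v; pose s := undup (dom u ++ dom v).
have us : uniq s by exact: undup_uniq.
have su : {subset dom u <= s} by move=> x; rewrite mem_undup mem_cat => ->.
have sv : {subset dom v <= s}.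
  by move=> x; rewrite mem_undup mem_cat => ->; rewrite orbT.
have suv : {subset dom (c *: u + v) <= s}.
  move=> x /domD_subset; rewrite mem_undup !mem_cat => /orP[/domZ_subset ->//|->].
  by rewrite orbT.
rewrite !(chain_pairing_sub f us)// big_distrr -big_split /=.
by apply: eq_bigr => x _; rewrite coeffD coeffZ mulrDl mulrA.
Qed.

HB.instance Definition _ f :=
  GRing.isLinear.Build R {freeg P / R} R *%R (chain_pairing f)
    (chain_pairing_linear f).

Definition pairing f (a : relchain) : R := chain_pairing f (repr a).

Lemma chain_pairing_sub0 f u : f (base_point P) = 0 -> u \in chain_in_sub ->
  chain_pairing f u = 0.
Proof.
move=> f0 /allP uA; rewrite /chain_pairing big_seq big1// => x /uA.
by rewrite -pi_base_point => /eqP ->; rewrite f0 mulr0.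
Qed.

Lemma pairing_relclass f u : f (base_point P) = 0 ->
  pairing f (relclass u) = chain_pairing f u.
Proof.
move=> f0; apply/eqP; rewrite -subr_eq0 -raddfB; apply/eqP.
apply: chain_pairing_sub0 => //.
by apply/relclassP; rewrite relclass_repr.
Qed.

Lemma pairingD f a b : f (base_point P) = 0 ->
  pairing f (a + b) = pairing f a + pairing f b.
Proof.
move=> f0; rewrite -(relclass_repr a) -(relclass_repr b) -raddfD.
by rewrite !pairing_relclass// raddfD.
Qed.

Lemma pairingZ f c a : f (base_point P) = 0 ->
  pairing f (c *: a) = c * pairing f a.
Proof.
move=> f0; rewrite -(relclass_repr a) -linearZ.
by rewrite !pairing_relclass// linearZ.
Qed.

Definition lip1_pointed : set (Q -> R) :=
  [set f | f (base_point P) = 0 /\ (Lip mdist (@norm_dist R R) f <= 1)%E].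

(* This norm makes [relchain] a [normedModType] below. *)
Definition W1_norm (a : relchain) : R :=
  sup [set pairing f a | f in lip1_pointed].

Lemma lip1_pointed_norm f x : lip1_pointed f ->
  `|f x| <= mdist x (base_point P).
Proof. by move=> [f0 /Lip_le1/(_ x (base_point P))]; rewrite f0 subr0. Qed.

Lemma lip1_pointedN f : lip1_pointed f -> lip1_pointed (fun x => - f x).
Proof.
move=> [f0 /Lip_le1 f1]; split; first by rewrite f0 oppr0.
by apply/Lip_le1 => x y; rewrite -opprD normrN.
Qed.

Lemma lip1_pointed0 : lip1_pointed (fun=> 0).
Proof.
by split => //; apply/Lip_le1 => x y; rewrite subrr normr0 mdist_ge0.
Qed.

Lemma pairingN f a : pairing (fun x => - f x) a = - pairing f a.
Proof.
rewrite /pairing /chain_pairing -sumrN; apply: eq_bigr => x _.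
by rewrite mulrN.
Qed.

Lemma has_sup_W1 a : has_sup [set pairing f a | f in lip1_pointed].
Proof.
split; first by exists (pairing (fun=> 0) a), (fun=> 0) => //; exact: lip1_pointed0.
pose u : {freeg P / R} := repr a.
exists (\sum_(x <- dom u) `|coeff x u| * mdist (\pi_Q x) (base_point P)).
move=> _ [f f1 <-]; apply: ler_sum => x _.
rewrite (le_trans (ler_norm _))// normrM ler_wpM2l//.
exact: lip1_pointed_norm.
Qed.

Lemma W1_norm_ge f a : lip1_pointed f -> `|pairing f a| <= W1_norm a.
Proof.
have [_ ub] := has_sup_W1 a.
move=> f1; rewrite ler_norml lerNl -pairingN; apply/andP; split;
  apply: ub_le_sup => //; [|by exists f].
by exists (fun x => - f x) => //; exact: lip1_pointedN.
Qed.

Lemma W1_norm_le a (M : R) :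
  (forall f, lip1_pointed f -> pairing f a <= M) -> W1_norm a <= M.
Proof.
by move=> h; apply: ge_sup => [|_ [f f1 <-]]; [have [] := has_sup_W1 a|exact: h].
Qed.

Lemma W1_normD a b : W1_norm (a + b) <= W1_norm a + W1_norm b.
Proof.
apply: W1_norm_le => f f1; rewrite pairingD; last by case: f1.
by apply: lerD; apply: le_trans (ler_norm _) _; exact: W1_norm_ge.
Qed.

Lemma W1_norm_ge0 a : 0 <= W1_norm a.
Proof. exact: le_trans (normr_ge0 _) (W1_norm_ge a lip1_pointed0). Qed.

Lemma W1_normZ c a : W1_norm (c *: a) = `|c| * W1_norm a.
Proof.
have le c' a' : W1_norm (c' *: a') <= `|c'| * W1_norm a'.
  apply: W1_norm_le => f f1; rewrite pairingZ; last by case: f1.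
  by rewrite (le_trans (ler_norm _))// normrM ler_wpM2l// W1_norm_ge.
apply/eqP; rewrite eq_le le /=; have [->|c0] := eqVneq c 0.
  by rewrite normr0 mul0r W1_norm_ge0.
rewrite -ler_pdivlMl ?normr_gt0// -normfV.
by rewrite -[X in W1_norm X <= _](scalerK c0) le.
Qed.

Lemma W1_norm_eq0 a : W1_norm a = 0 -> a = 0.
Proof.
pose u : {freeg P / R} := repr a.
move=> a0; apply/eqP; rewrite -(relclass_repr a) -(raddf0 relclass).
apply/eqP/relclassP; rewrite subr0; apply/chain_in_subP => x0 x0A.
pose p0 : Q := \pi_Q x0.
pose D : seq R := mdist (base_point P) p0 ::
  [seq mdist (\pi_Q x) p0 | x <- dom u & x != x0].
have D0 : all (fun r => 0 < r) D.
  rewrite /= mdist_gt0 eq_sym pi_base_point x0A/=.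
  apply/allP => r /mapP[x]; rewrite mem_filter => /andP[xx0 _] ->.
  rewrite mdist_gt0; apply/eqP => /eqquotP; rewrite /collapse /= .
  by rewrite (negPf xx0) (negPf x0A) andbF.
have [e e0 eD] : exists2 e : R, 0 < e & forall r, r \in D -> e <= r.
  elim: (D) D0 => [_|r s IHs /= /andP[r0 /IHs[e e0 es]]]; first by exists 1.
  exists (Num.min r e); first by rewrite lt_min r0.
  by move=> q; rewrite in_cons ge_min => /orP[/eqP ->|/es ->]; rewrite ?lexx ?orbT.
pose f (q : Q) : R := Num.max 0 (e - mdist q p0).
have f1 : lip1_pointed f.
  split.
    by apply/max_idPl; rewrite subr_le0; apply: eD; rewrite mem_head.
  apply/Lip_le1 => x y; rewrite /f.
  wlog xy : x y / mdist x p0 <= mdist y p0.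
    move=> h; have [/h//|/ltW/h] := leP (mdist x p0) (mdist y p0).
    by rewrite distrC [mdist y x]metric_sym.
  have yx : mdist y p0 <= mdist x y + mdist x p0.
    by rewrite [mdist x y]metric_sym; exact: metric_triangle.
  rewrite ger0_norm; last first.
    by rewrite subr_ge0 ge_max le_max lexx /= le_max lerD2l lerN2 xy orbT.
  rewrite lerBlDr ge_max addr_ge0 ?le_max ?lexx ?mdist_ge0//=.
  apply: (@le_trans _ _ (mdist x y + (e - mdist y p0))).
    by rewrite addrCA lerD2l lerBrDr addrC lerBlDr.
  by rewrite lerD2l le_max lexx orbT.
have : `|pairing f a| <= 0 by rewrite -a0; exact: W1_norm_ge.
rewrite normr_le0 /pairing => /eqP.
rewrite /chain_pairing -/u; have [x0u|x0u] := boolP (x0 \in dom u); last first.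
  by rewrite coeff_outdom.
rewrite (bigD1_seq x0) ?uniq_dom//= big_seq_cond big1 ?addr0; last first.
  move=> x /andP[xu xx0]; rewrite /f (max_idPl _) ?mulr0// subr_le0.
  apply: eD; rewrite in_cons; apply/orP; right; apply/mapP; exists x => //.
  by rewrite mem_filter xx0.
rewrite /f mdistxx subr0 (max_idPr (ltW e0)) => /eqP.
by rewrite mulf_eq0 (gt_eqF e0) orbF => /eqP.
Qed.

HB.instance Definition _ := Lmodule_isNormed.Build R relchain
  W1_normD W1_normZ W1_norm_eq0.

End relative_chains.

Section ell2.
Context {R : realType}.
Implicit Types (a b : nat -> R) (c : R).

Definition square_summable : {pred nat -> R} :=
  fun a => `[< cvgn (series (fun n => a n ^+ 2)) >].

Lemma square_summableP a :
  reflect (cvgn (series (fun n => a n ^+ 2))) (a \in square_summable).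
Proof. exact: asboolP. Qed.

Lemma square_summable_submod : submod_closed square_summable.
Proof.
split.
  apply/square_summableP; rewrite [X in series X](_ : _ = fun=> 0).
    rewrite [series _](_ : _ = fun=> 0); first exact: is_cvg_cst.
    by apply/funext => n; rewrite /series /= big1.
  by apply/funext => n; rewrite expr0n.
move=> c a b /square_summableP ca /square_summableP cb; apply/square_summableP.
apply: (@series_le_cvg _ _
  (2 * c ^+ 2 *: (fun n => a n ^+ 2) + 2 *: (fun n => b n ^+ 2))) => [n|n|n|].
- exact: sqr_ge0.
- rewrite -[leRHS]/(2 * c ^+ 2 * a n ^+ 2 + 2 * b n ^+ 2).
  by rewrite -mulrA -exprMn addr_ge0// mulr_ge0// sqr_ge0.
- rewrite -[X in X ^+ 2]/(c * a n + b n) -[leRHS]/(2 * c ^+ 2 * a n ^+ 2 + 2 * b n ^+ 2).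
  rewrite -subr_ge0.
  have -> : 2 * c ^+ 2 * a n ^+ 2 + 2 * b n ^+ 2 - (c * a n + b n) ^+ 2 =
    (c * a n - b n) ^+ 2 by ring.
  exact: sqr_ge0.
- by rewrite seriesD; apply: is_cvgD; rewrite seriesZ; exact: is_cvgZr.
Qed.

HB.instance Definition _ :=
  GRing.isSubmodClosed.Build R (nat -> R) square_summable square_summable_submod.

End ell2.

Record ell2 (R : realType) := Ell2 {
  ell2_seq :> nat -> R ;
  ell2_square_summable : ell2_seq \in square_summable
}.

Section ell2_theory.
Context {R : realType}.

HB.instance Definition _ := [isSub for @ell2_seq R].
HB.instance Definition _ := [Choice of ell2 R by <:].
HB.instance Definition _ := [SubChoice_isSubLmodule of ell2 R by <:].

Implicit Types u v w : ell2 R.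

Definition ell2_dot u v : R := limn (series (fun n => u n * v n)).

Definition ell2_norm u : R := Num.sqrt (ell2_dot u u).

Lemma ell2P u v : (forall n, u n = v n) -> u = v.
Proof. by move=> uv; apply/val_inj/funext. Qed.

Lemma ell2DE u v n : (u + v) n = u n + v n. Proof. by []. Qed.

Lemma ell2ZE c u n : (c *: u) n = c * u n. Proof. by []. Qed.

Lemma ell2_dot_cvg u v : series (fun n => u n * v n) @ \oo --> ell2_dot u v.
Proof.
apply: normed_cvg.
apply: (@series_le_cvg _ _ ((fun n => u n ^+ 2) + (fun n => v n ^+ 2)))
  => [n|n|n|] /=.
- exact: normr_ge0.
- by rewrite addr_ge0 ?sqr_ge0.
- rewrite -[leRHS]/(u n ^+ 2 + v n ^+ 2) normrM -[u n ^+ 2]real_normK ?num_real//.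
  rewrite -[v n ^+ 2]real_normK ?num_real// -subr_ge0.
  have : 0 <= (`|u n| - `|v n|) ^+ 2 by exact: sqr_ge0.
  have : 0 <= `|u n| * `|v n| by rewrite mulr_ge0.
  by nra.
- rewrite seriesD; apply: is_cvgD; apply/square_summableP;
    exact: ell2_square_summable.
Qed.

Lemma ell2_dotC u v : ell2_dot u v = ell2_dot v u.
Proof. by congr (limn (series _)); apply/funext => n; rewrite mulrC. Qed.

Lemma ell2_dotl c u v w :
  ell2_dot (c *: u + v) w = c * ell2_dot u w + ell2_dot v w.
Proof.
apply/cvg_lim => //.
rewrite [X in series X](_ : _ =
  c *: (fun n => u n * w n) + (fun n => v n * w n)); last first.
  apply/funext => n; rewrite ell2DE ell2ZE mulrDl -mulrA.
  by [].
rewrite seriesD; apply: cvgD; last exact: ell2_dot_cvg.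
by rewrite seriesZ; apply: cvgZr; exact: ell2_dot_cvg.
Qed.

Lemma ell2_dotDl u v w : ell2_dot (u + v) w = ell2_dot u w + ell2_dot v w.
Proof. by rewrite -[u]scale1r ell2_dotl mul1r scale1r. Qed.

Lemma ell2_dot0l w : ell2_dot 0 w = 0.
Proof.
by have /eqP := ell2_dotDl 0 0 w; rewrite addr0 -subr_eq0 opprD addNKr oppr_eq0 => /eqP.
Qed.

Lemma ell2_dotZl c u w : ell2_dot (c *: u) w = c * ell2_dot u w.
Proof. by rewrite -[c *: u]addr0 ell2_dotl ell2_dot0l addr0. Qed.

Lemma ell2_dotDr u v w : ell2_dot w (u + v) = ell2_dot w u + ell2_dot w v.
Proof. by rewrite !(ell2_dotC w) ell2_dotDl. Qed.

Lemma ell2_dotZr c u w : ell2_dot w (c *: u) = c * ell2_dot w u.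
Proof. by rewrite !(ell2_dotC w) ell2_dotZl. Qed.

Lemma ell2_dot_ge_coord u n : u n ^+ 2 <= ell2_dot u u.
Proof.
have h : nondecreasing_seq (series (fun n => u n * u n)).
  by apply/nondecreasing_series => k _ _; rewrite -expr2 sqr_ge0.
have := @nondecreasing_cvgn_le _ _ h _ n.+1.
move=> /(_ (cvgP _ (@ell2_dot_cvg u u))); apply: le_trans.
rewrite /series/= big_nat_recr//= expr2 lerDr sumr_ge0// => k _.
by rewrite -expr2 sqr_ge0.
Qed.

Lemma ell2_dot_ge0 u : 0 <= ell2_dot u u.
Proof. exact: le_trans (sqr_ge0 _) (ell2_dot_ge_coord u 0). Qed.

Lemma ell2_norm_sqr u : ell2_norm u ^+ 2 = ell2_dot u u.
Proof. by rewrite sqr_sqrtr// ell2_dot_ge0. Qed.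

Lemma ell2_norm_eq0 u : ell2_norm u = 0 -> u = 0.
Proof.
move=> u0; apply: ell2P => n; apply/eqP; rewrite -sqrf_eq0 eq_le sqr_ge0 andbT.
by rewrite (le_trans (ell2_dot_ge_coord u n))// -ell2_norm_sqr u0 expr0n.
Qed.

Lemma ell2_cauchy_schwarz u v : ell2_dot u v <= ell2_norm u * ell2_norm v.
Proof.
set a := ell2_norm u; set b := ell2_norm v.
have [/ell2_norm_eq0 ->|a0] := eqVneq a 0.
  by rewrite ell2_dot0l mulr_ge0 ?sqrtr_ge0.
have [/ell2_norm_eq0 ->|b0] := eqVneq b 0.
  by rewrite ell2_dotC ell2_dot0l mulr_ge0 ?sqrtr_ge0.
have ab : 0 < a * b by rewrite mulr_gt0// lt_def ?a0 ?b0 sqrtr_ge0.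
have := ell2_dot_ge0 (b *: u - a *: v).
rewrite -scaleNr !(ell2_dotDl, ell2_dotDr, ell2_dotZl, ell2_dotZr).
rewrite [ell2_dot v u]ell2_dotC -!ell2_norm_sqr.
rewrite -/a -/b => h; rewrite -(ler_pM2l ab); nra.
Qed.

Lemma ell2_normD u v : ell2_norm (u + v) <= ell2_norm u + ell2_norm v.
Proof.
rewrite -ler_sqr ?nnegrE ?addr_ge0 ?sqrtr_ge0// sqrrD !ell2_norm_sqr.
rewrite !(ell2_dotDl, ell2_dotDr) [ell2_dot v u]ell2_dotC.
have := ell2_cauchy_schwarz u v; rewrite mulr2n; lra.
Qed.

Lemma ell2_normZ c u : ell2_norm (c *: u) = `|c| * ell2_norm u.
Proof.
rewrite /ell2_norm ell2_dotZl ell2_dotZr mulrA -expr2.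
by rewrite sqrtrM ?sqr_ge0// sqrtr_sqr.
Qed.

HB.instance Definition _ := Lmodule_isNormed.Build R (ell2 R)
  ell2_normD ell2_normZ ell2_norm_eq0.

Lemma ell2_mul_subproof (m : nat -> R) (M : R) (mM : forall n, `|m n| <= M) u :
  (fun n => m n * u n) \in square_summable.
Proof.
apply/square_summableP.
apply: (@series_le_cvg _ _ (M ^+ 2 *: (fun n => u n ^+ 2))) => [n|n|n|].
- exact: sqr_ge0.
- by rewrite -[leRHS]/(M ^+ 2 * u n ^+ 2) mulr_ge0 ?sqr_ge0.
- rewrite -[leRHS]/(M ^+ 2 * u n ^+ 2) exprMn ler_wpM2r ?sqr_ge0//.
  by rewrite -[leLHS]real_normK ?num_real// lerXn2r ?nnegrE// (le_trans _ (mM n)).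
- rewrite seriesZ; apply: is_cvgZr; apply/square_summableP.
  exact: ell2_square_summable.
Qed.

Definition ell2_mul (m : nat -> R) (M : R) (mM : forall n, `|m n| <= M) u :
  ell2 R := Ell2 (ell2_mul_subproof mM u).

Lemma ell2_basis_subproof k : (fun n => (n == k)%:R : R) \in square_summable.
Proof.
apply/square_summableP; apply: (cvgP (1 : R)); apply: cvg_near_cst.
exists k.+1 => // n /= kn; rewrite /series /=.
rewrite (bigD1_seq k) ?mem_index_iota ?iota_uniq//= eqxx expr1n.
by rewrite big1 ?addr0// => i /negPf ->; rewrite expr0n.
Qed.

Definition ell2_basis (k : nat) : ell2 R := Ell2 (ell2_basis_subproof k).

End ell2_theory.

Section operator_norm.
Context {R : realType} {V W : normedModType R}.

(* Meaningful for bounded [f]: [sup] is [0] on unbounded sets. *)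
Definition opnorm (f : V -> W) : R := sup [set `|f x| | x in [set x | `|x| <= 1]].

Lemma ler_opnorm (f : {linear V -> W}) (x : V) : continuous f ->
  `|f x| <= opnorm f * `|x|.
Proof.
move=> /linear_bounded_continuous/linear_boundedP/pinfty_ex_gt0[M M0 fM].
have [->|x0] := eqVneq x 0; first by rewrite linear0 !normr0 mulr0.
rewrite -ler_pdivrMr ?normr_gt0//.
apply: ub_le_sup.
  exists M => _ [y /= y1 <-]; rewrite (le_trans (fM y))// ler_piMr//.
  exact: ltW.
exists (`|x|^-1 *: x) => /=.
  by rewrite normrZ normfV normr_id mulVf// normr_eq0.
by rewrite linearZ normrZ normfV normr_id mulrC.
Qed.

End operator_norm.

(* [V -> B] exhibits [B] as the Banach completion of [V]. *)
Definition is_completion {R : realType} {V : normedModType R}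
    {B : completeNormedModType R} (i : {linear V -> B}) : Prop :=
  (forall v, `|i v| = `|v|) /\ dense (range i).

Record covariance_data (R : realType) (B : completeNormedModType R) :=
  CovarianceData {
  cov_ell : nat -> {linear B -> R} ;
  cov_ell_continuous : forall n, continuous (cov_ell n) ;
  cov_ell_norm_le1 : forall n, opnorm (cov_ell n) <= 1 ;
  cov_ell_norming : forall x : B, `|x| = sup [set `|cov_ell n x| | n in [set: nat]] ;
  cov_w : ell2 R ;
  cov_w_gt0 : forall n, 0 < cov_w n ;
  cov_sigma : nat -> R ;
  cov_sigma_ge0 : forall n, 0 <= cov_sigma n ;
  cov_sigma_summable : cvgn (series cov_sigma)
}.

Section covariance_data_theory.
Context {R : realType} {B : completeNormedModType R} (D : covariance_data B).

Lemma cov_ell_le x n : `|cov_ell D n x| <= `|x|.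
Proof.
rewrite (le_trans (ler_opnorm _ (@cov_ell_continuous _ _ D n)))//.
by rewrite ler_piMl// cov_ell_norm_le1.
Qed.

(* [J x = (w_n l_n(x))_n]. *)
Definition cov_J (x : B) : ell2 R := ell2_mul (cov_ell_le x) (cov_w D).

Lemma cov_JE x n : cov_J x n = cov_w D n * cov_ell D n x.
Proof. exact: mulrC. Qed.

Lemma cov_J_linear : linear cov_J.
Proof.
move=> c x y; apply: ell2P => n.
by rewrite ell2DE ell2ZE !cov_JE linearP mulrDr mulrCA.
Qed.

HB.instance Definition _ := GRing.isLinear.Build R B (ell2 R) *:%R cov_J cov_J_linear.

Lemma cov_sigma_bounded n : `|cov_sigma D n| <= limn (series (cov_sigma D)).
Proof.
have nd : nondecreasing_seq (series (cov_sigma D)).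
  by apply/nondecreasing_series => k _ _; exact: cov_sigma_ge0.
have := @nondecreasing_cvgn_le _ _ nd (@cov_sigma_summable _ _ D) n.+1.
apply: le_trans; rewrite ger0_norm ?cov_sigma_ge0// /series/= big_nat_recr//=.
by rewrite lerDr sumr_ge0// => k _; exact: cov_sigma_ge0.
Qed.

(* The positive trace-class operator with [Sigma e_n = sigma_n e_n]
   ([cov_Sigma_basis]). *)
Definition cov_Sigma (h : ell2 R) : ell2 R := ell2_mul cov_sigma_bounded h.

Lemma cov_SigmaE h n : cov_Sigma h n = cov_sigma D n * h n.
Proof. by []. Qed.

Lemma cov_Sigma_linear : linear cov_Sigma.
Proof.
move=> c x y; apply: ell2P => n.
by rewrite ell2DE ell2ZE !cov_SigmaE ell2DE ell2ZE mulrDr mulrCA.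
Qed.

HB.instance Definition _ :=
  GRing.isLinear.Build R (ell2 R) (ell2 R) *:%R cov_Sigma cov_Sigma_linear.

Lemma cov_Sigma_basis n :
  cov_Sigma (ell2_basis n) = cov_sigma D n *: ell2_basis n.
Proof.
apply: ell2P => k; rewrite cov_SigmaE ell2ZE /=.
by case: eqP => [->//|_]; rewrite !mulr0.
Qed.

End covariance_data_theory.

Notation borel T := (g_sigma_algebraType (@open T)).

Section gaussian.
Context {R : realType}.
Local Open Scope ereal_scope.

Definition is_radon (gamma : probability (borel (ell2 R)) R) : Prop :=
  forall E : set (borel (ell2 R)), measurable E ->
    gamma E = ereal_sup [set gamma K | K in
      [set K : set (ell2 R) | compact K /\ K `<=` E]].

(* The characteristic function
   [h |-> \int e^(i <h, u>) d gamma(u) = exp(- <Sigma h, h> / 2)]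
   is given by its real and imaginary parts. *)
Definition is_centered_gaussian (Sigma : ell2 R -> ell2 R)
    (gamma : probability (borel (ell2 R)) R) : Prop :=
  is_radon gamma /\
  forall h : ell2 R,
    \int[gamma]_u (cos (ell2_dot h u))%:E =
      (expR (- (2^-1 * ell2_dot (Sigma h) h)))%:E /\
    \int[gamma]_u (sin (ell2_dot h u))%:E = 0.

End gaussian.

Section independence.
Context {R : realType} {d d' : measure_display} {Omega : measurableType d}
  {T : measurableType d'} (Pr : probability Omega R) {N : nat}.
Variable u : 'I_N -> {RV Pr >-> T}.
Local Open Scope ereal_scope.

Definition mutually_independent : Prop :=
  forall (I : {set 'I_N}) (E : 'I_N -> set T), (forall r, measurable (E r)) ->
    Pr (\big[setI/setT]_(r in I) (u r @^-1` E r)) =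
    \prod_(r in I) Pr (u r @^-1` E r).

Definition iid_samples (gamma : probability T R) : Prop :=
  mutually_independent /\
  forall r E, measurable E -> distribution Pr (u r) E = gamma E.

End independence.

Section random_features.
Context {R : realType} {N : nat}.

Definition expi (s : R) : R[i] := (cos s +i* sin s)%C.

(* The Euclidean norm on [C^N]; the library's norm on ['rV_N] is the sup norm. *)
Definition Cl2_norm (z : 'rV[R[i]]_N) : R :=
  Num.sqrt (\sum_(r < N) Normc.normc (z ord0 r) ^+ 2).

Definition Cl2_dist (y z : 'rV[R[i]]_N) : R := Cl2_norm (y - z).

Definition random_feature {V : Type} (t : R) (J : V -> ell2 R)
    (u : 'I_N -> ell2 R) (x : V) : 'rV[R[i]]_N :=
  \row_(r < N) (((Num.sqrt N%:R)^-1)%:C%C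
                * expi (Num.sqrt t * ell2_dot (J x) (u r))).

End random_features.

(* Main.v *)
Require Import Defs.
From HB Require Import structures.
From mathcomp Require Import all_boot all_order all_algebra.
From mathcomp Require Import all_classical all_reals all_analysis.
From mathcomp Require Import complex.
From mathcomp Require Import ring.

Import Order.TTheory GRing.Theory Num.Theory.
Import numFieldNormedType.Exports.
Local Open Scope classical_set_scope.
Local Open Scope ring_scope.

(** Each coordinate of the feature map is the phase [s |-> expi s], which is
    [1]-Lipschitz from the line to the complex plane, applied to the scalar
    [sqrt t * <J x, u_r>].  By Cauchy-Schwarz two such scalars differ by at
    most [sqrt t * |J x - J y| * |u_r|], so summing squares over the [N]
    coordinates, each carrying the weight [N^-1], gives
      [|Phi x - Phi y| <= sqrt t * |J x - J y| * sqrt (N^-1 * sum_r |u_r|^2)]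
    ([Cl2_dist_random_feature_le]).  The weights [w_n] of [J] are square
    summable and the functionals [l_n] have norm at most [1], so [J] is a
    bounded operator ([cov_J_continuous]); hence
    [|J x - J y| <= opnorm J * |x - y|]. *)

Lemma normr_sin_le {R : realType} (x : R) : `|sin x| <= `|x|.
Proof.
wlog x0 : x / 0 <= x => [H|].
  have [/H//|x0] := leP 0 x.
  by rewrite -normrN -sinN -(normrN x); apply: H; rewrite oppr_ge0 ltW.
have [|c _] := @MVT_segment R sin cos 0 x x0 (fun y _ => is_derive_sin y).
  by apply: continuous_subspaceT => y; exact: continuous_sin.
rewrite sin0 !subr0 => ->.
by rewrite normrM ler_piMl// cos_max.
Qed.

(** The chord of the unit circle subtending the angle [a - b] has length
    [2 * |sin ((a - b) / 2)|], which is at most the arc [|a - b|]. *)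
Lemma normc_expi_sub_le {R : realType} (a b : R) :
  Normc.normc (expi a - expi b) <= `|a - b|.
Proof.
rewrite -sqrtr_sqr ler_sqrt ?sqr_ge0//.
set s := (a - b) / 2.
have -> : (cos a - cos b) ^+ 2 + (sin a - sin b) ^+ 2 = (2 * sin s) ^+ 2.
  have chordE : (cos a - cos b) ^+ 2 + (sin a - sin b) ^+ 2 =
      (cos a ^+ 2 + sin a ^+ 2) + (cos b ^+ 2 + sin b ^+ 2) - 2 * cos (a - b).
    by rewrite cosB; ring.
  have -> : (2 * sin s) ^+ 2 = 4 * (1 - cos s ^+ 2) by rewrite -sin2cos2; ring.
  rewrite chordE !cos2Dsin2.
  have -> : a - b = s *+ 2 by rewrite -(mulr_natr s) mulfVK// pnatr_eq0.
  by rewrite cos_mulr2n; ring.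
rewrite -[leLHS]real_normK ?num_real// -[leRHS]real_normK ?num_real//.
rewrite lerXn2r ?nnegrE//.
have -> : a - b = 2 * s by rewrite /s mulrC mulfVK// pnatr_eq0.
by rewrite [leLHS]normrM [leRHS]normrM ler_wpM2l// normr_sin_le.
Qed.

Lemma normr_ell2_dot_le {R : realType} (u v : ell2 R) :
  `|ell2_dot u v| <= `|u| * `|v|.
Proof.
rewrite ler_norml ell2_cauchy_schwarz andbT lerNl -mulN1r -ell2_dotZl.
by rewrite (le_trans (ell2_cauchy_schwarz _ _))// ell2_normZ normrN1 mul1r.
Qed.

Lemma normr_ell2_mul_le {R : realType} (m : nat -> R) (M : R)
  (mM : forall n, `|m n| <= M) (u : ell2 R) : `|ell2_mul mM u| <= M * `|u|.
Proof.
have M0 : 0 <= M by exact: le_trans (normr_ge0 _) (mM 0%N).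
rewrite -[leRHS]ger0_norm ?mulr_ge0// -sqrtr_sqr ler_sqrt ?sqr_ge0//.
rewrite exprMn -[`|u|]/(ell2_norm u) ell2_norm_sqr.
have -> : M ^+ 2 * ell2_dot u u =
    limn (series (M ^+ 2 *: (fun n => u n * u n))).
  apply/esym/cvg_lim => //; rewrite seriesZ.
  by apply: cvgZr; exact: ell2_dot_cvg.
apply: lim_series_le => [||n].
- exact: cvgP (@ell2_dot_cvg _ _ _).
- by rewrite seriesZ; apply: is_cvgZr; exact: cvgP (@ell2_dot_cvg _ _ _).
rewrite -[leLHS]/((m n * u n) * (m n * u n)) -[leRHS]/(M ^+ 2 * (u n * u n)).
rewrite -!expr2 exprMn ler_wpM2r ?sqr_ge0// -[m n ^+ 2]real_normK ?num_real//.
by rewrite lerXn2r ?nnegrE.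
Qed.

(** [J x] is the pointwise product of the sequence [(l_n x)_n], bounded by
    [|x|], with the square-summable weights, so [|J x| <= |x| * |w|]. *)
Lemma cov_J_continuous {R : realType} {B : completeNormedModType R}
  (D : covariance_data B) : continuous (cov_J D).
Proof.
apply/linear_bounded_continuous/linear_boundedP.
exists `|cov_w D|; split; first exact: num_real.
move=> r /ltW wr x.
by rewrite (le_trans (normr_ell2_mul_le _ _ _ _))// mulrC ler_wpM2r.
Qed.

(** When the set of values is unbounded, its [sup] is [0] by convention. *)
Lemma opnorm_ge0 {R : realType} {V W : normedModType R} (f : V -> W) :
  0 <= opnorm f.
Proof.
rewrite /opnorm; set S := [set _ | _ in _].
have [Ssup|/sup_out -> //] := pselect (has_sup S).
have [[y Sy] _] := Ssup; rewrite (le_trans _ (sup_upper_bound Ssup Sy))//.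
by case: Sy => x _ <-.
Qed.

(** Coordinatewise, the phase is [1]-Lipschitz and Cauchy-Schwarz bounds
    [|<J x - J y, u_r>|]; the factor [N^-1] is the square of [(sqrt N)^-1]. *)
Lemma Cl2_dist_random_feature_le {R : realType} {V : Type} {N : nat} (t : R)
  (J : V -> ell2 R) (u : 'I_N -> ell2 R) (x y : V) : 0 <= t ->
  Cl2_dist (random_feature t J u x) (random_feature t J u y) <=
  Num.sqrt t * `|J x - J y| * Num.sqrt (N%:R^-1 * \sum_(r < N) `|u r| ^+ 2).
Proof.
move=> t0; set K := Num.sqrt t * `|J x - J y|.
have K0 : 0 <= K by rewrite mulr_ge0 ?sqrtr_ge0.
have -> : K * Num.sqrt (N%:R^-1 * \sum_(r < N) `|u r| ^+ 2) =
    Num.sqrt (K ^+ 2 * (N%:R^-1 * \sum_(r < N) `|u r| ^+ 2)).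
  by rewrite [RHS]sqrtrM ?sqr_ge0// sqrtr_sqr ger0_norm.
rewrite ler_sqrt; last first.
  by rewrite !mulr_ge0 ?sqr_ge0 ?invr_ge0 ?sumr_ge0// => r _; exact: sqr_ge0.
rewrite mulrA mulr_sumr; apply: ler_sum => r _.
rewrite !mxE -mulrBr Normc.normcM exprMn.
have -> : Normc.normc (((Num.sqrt N%:R)^-1)%:C%C : R[i]) ^+ 2 = N%:R^-1 :> R.
  by rewrite /= expr0n addr0 sqrtr_sqr real_normK ?num_real// exprVn sqr_sqrtr.
rewrite [K ^+ 2 * _]mulrC -mulrA ler_wpM2l ?invr_ge0// -exprMn.
rewrite lerXn2r ?nnegrE ?mulr_ge0 ?sqrtr_ge0//.
rewrite (le_trans (normc_expi_sub_le _ _))// -mulrBr.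
rewrite -mulN1r -ell2_dotZl -ell2_dotDl scaleN1r normrM.
rewrite ger0_norm ?sqrtr_ge0// /K -mulrA ler_wpM2l ?sqrtr_ge0//.
exact: normr_ell2_dot_le.
Qed.

(** A pair at distance [0] contributes [0 / 0 = 0] to the supremum defining
    [Lip], which is where [0 <= K] enters. *)
Lemma Lip_le {R : realType} {T U : Type} (dT : T -> T -> R) (dU : U -> U -> R)
  (f : T -> U) (K : R) : 0 <= K -> (forall x y, 0 <= dT x y) ->
  (forall x y, dU (f x) (f y) <= K * dT x y) -> (Lip dT dU f <= K%:E)%E.
Proof.
move=> K0 dT0 fK; apply: ge_ereal_sup => _ [[x y] _ <-] /=; rewrite lee_fin.
have [->|xy] := eqVneq (dT x y) 0; first by rewrite invr0 mulr0.
by rewrite ler_pdivrMr ?fK// lt_def xy dT0.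
Qed.

Theorem corollary4p9 (R : realType) (P : metricPair R)
  (P_separable : separable (pair_quotient P))
  (P_not_discrete : ~ uniformly_discrete (pair_quotient P))
  (B : completeNormedModType R) (iota : {linear relchain P -> B})
  (B_completion : is_completion iota)
  (D : covariance_data B)
  (t : R) (t_gt0 : 0 < t)
  (N : nat) (N_ge1 : (1 <= N)%N)
  (gamma : probability (borel (ell2 R)) R)
  (gamma_gaussian : is_centered_gaussian (cov_Sigma D) gamma)
  (d : measure_display) (Omega : measurableType d) (Pr : probability Omega R)
  (u : 'I_N -> {RV Pr >-> borel (ell2 R)})
  (u_samples : iid_samples u gamma)
  (omega : Omega) :
  let Phi : B -> 'rV[R[i]]_N :=
    random_feature t (cov_J D) (fun r => u r omega : ell2 R) in
  is_lipschitz norm_dist Cl2_dist Phi /\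
  (Lip norm_dist Cl2_dist Phi <=
    (Num.sqrt t * opnorm (cov_J D) *
     Num.sqrt (N%:R^-1 * \sum_(r < N) `|u r omega : ell2 R| ^+ 2))%:E)%E.
Proof.
move=> Phi.
set K := _ * _ * _.
have PhiK x y : Cl2_dist (Phi x) (Phi y) <= K * norm_dist x y.
  rewrite (le_trans (Cl2_dist_random_feature_le _ _ _ _ _ (ltW t_gt0)))//.
  rewrite /K [leRHS]mulrAC ler_wpM2r ?sqrtr_ge0// -mulrA ler_wpM2l ?sqrtr_ge0//.
  by rewrite -linearB ler_opnorm//; exact: cov_J_continuous.
split; first by exists K.
apply: Lip_le PhiK => [|x y]; last exact: normr_ge0.
by rewrite !mulr_ge0 ?sqrtr_ge0 ?opnorm_ge0.
Qed.
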